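(* Let $c>1$ satisfy $\sum_{x\ge1}\sum_{y\ge1}(x y+1)^{-c}>1$. Then $u(n)=\Omega(n^c)$; that is, there exists a constant $a>0$ with $u(n)\ge a\,n^c$ for all positive integers $n$. Here $u(n)$ denotes the minimum number of leaves of a rooted tree that contains, as a topological minor, every rooted tree with $n$ leaves and no degree-1 nodes.
   Context: Trees are rooted and unordered, with edges directed from parent to child. The degree of a node is its number of children; a degree-1 node has exactly one child. $T'$ is a topological minor of $T$ if there is an injective map $f$ from the nodes of $T'$ to the nodes of $T$ with $f(\mathsf{NCA}(u,v))=\mathsf{NCA}(f(u),f(v))$ for all $u,v$. Equivalently, $T$ contains a subdivision of $T'$ as a subgraph. $\mathsf{NCA}$ denotes the nearest common ancestor. *)

(* Defs.v *)
From Stdlib Require Import Reals List Arith.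
From Coquelicot Require Import Coquelicot.
Import ListNotations.

(* Finite rooted trees; the order of children is irrelevant for everything
   below (topological minors are defined via NCA-preserving maps). *)
Inductive tree : Type := Node : list tree -> tree.

Fixpoint subtree_at (t : tree) (p : list nat) : option tree :=
  match p with
  | nil => Some t
  | i :: p' =>
      match t with
      | Node cs =>
          match nth_error cs i with
          | Some c => subtree_at c p'
          | None => None
          end
      end
  end.

Definition is_node (t : tree) (p : list nat) : Prop := subtree_at t p <> None.

Fixpoint nca (p q : list nat) : list nat :=
  match p, q with
  | a :: p', b :: q' => if Nat.eqb a b then a :: nca p' q' else nil
  | _, _ => nil
  end.

Definition topological_minor (T' T : tree) : Prop :=
  exists f : list nat -> list nat,
    (forall p, is_node T' p -> is_node T (f p)) /\
    (forall p q, is_node T' p -> is_node T' q -> f p = f q -> p = q) /\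
    (forall p q, is_node T' p -> is_node T' q -> f (nca p q) = nca (f p) (f q)).

Fixpoint nleaves (t : tree) : nat :=
  match t with
  | Node cs =>
      match cs with
      | nil => 1
      | _ => list_sum (map nleaves cs)
      end
  end.

Definition no_degree_one (t : tree) : Prop :=
  forall p c, subtree_at t p <> Some (Node [c]).

Definition universal (n : nat) (U : tree) : Prop :=
  forall T, nleaves T = n -> no_degree_one T -> topological_minor T U.

(* Main.v *)
(** For a word [s = (x_1,y_1) ... (x_k,y_k)] let [T_s] be the caterpillar with
    [x_1] spine nodes, each carrying [y_1] copies of [T_(s')], with one more copy
    at the bottom, where [s'] is the tail of [s].  A tree [U] contains at most
    [nleaves U] of the [T_s], counted by words: if [T_s] lies in [k_s] of the
    subtrees hanging from the root, then [s] is the tail of at most [k_s - 1]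
    words which are contained in [U] but in none of these subtrees, because for
    every [y < k_s] at most one value of [x] is new.  Hence the number of words
    in [U] is at most the sum of the [k_s], and induction applies.  On the other
    hand [T_s] has [prod (x_i y_i + 1)] leaves, so the number [N(t)] of words
    with at most [t] leaves satisfies [N(t) = 1 + sum N(t / (x y + 1))], whence
    [N(t) >= a t^c]. *)
Require Import Defs.
From Stdlib Require Import Reals List Arith.
From Coquelicot Require Import Coquelicot.
From Stdlib Require Import Lia Lra Classical ClassicalEpsilon.
Import ListNotations.

(** * Topological minors and the children of the root *)

Fixpoint tree_nested_ind (P : tree -> Prop)
    (H : forall cs, (forall c, In c cs -> P c) -> P (Node cs)) (t : tree) : P t :=
  match t with
  | Node cs => H cs
      ((fix go (l : list tree) : forall c, In c l -> P c :=
          match l with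
          | [] => fun c h => False_ind (P c) h
          | d :: l' => fun c h =>
              match h with
              | or_introl e => eq_ind d P (tree_nested_ind P H d) c e
              | or_intror h' => go l' c h'
              end
          end) cs)
  end.

Lemma is_node_nil (t : tree) : is_node t [].
Proof. discriminate. Qed.

Lemma is_node_cons (ts : list tree) (i : nat) (p : list nat) :
  is_node (Node ts) (i :: p) <-> exists t, nth_error ts i = Some t /\ is_node t p.
Proof.
  unfold is_node; simpl.
  destruct (nth_error ts i) as [t|]; split.
  - intros H; exists t; auto.
  - intros (t' & E & H); injection E as <-; exact H.
  - intros H; now destruct H.
  - intros (t' & E & _); discriminate E.
Qed.

Lemma nca_cons (i : nat) (p q : list nat) : nca (i :: p) (i :: q) = i :: nca p q.
Proof. simpl; now rewrite Nat.eqb_refl. Qed.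

Lemma nca_prefix_hd (j : nat) (p q : list nat) :
  nca (j :: p) q = j :: p -> exists q', q = j :: q'.
Proof.
  destruct q as [|k q]; simpl; [discriminate|].
  destruct (Nat.eqb_spec j k) as [<-|]; [eauto|discriminate].
Qed.

Lemma topological_minor_leaf (U : tree) : topological_minor (Node []) U.
Proof.
  assert (H : forall p, is_node (Node []) p -> p = []).
  { intros [|i p]; auto. intros (t & E & _)%is_node_cons.
    now destruct i. }
  exists (fun _ => []); repeat split.
  - intros; apply is_node_nil.
  - intros p q hp hq _. now rewrite (H p hp), (H q hq).
Qed.

Lemma topological_minor_child (ts : list tree) (i : nat) (t U : tree) :
  nth_error ts i = Some t -> topological_minor (Node ts) U -> topological_minor t U.
Proof.
  intros E (f & fn & fi & fm).
  assert (N : forall p, is_node t p -> is_node (Node ts) (i :: p)).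
  { intros p hp; apply is_node_cons; eauto. }
  exists (fun p => f (i :: p)); repeat split.
  - intros p hp; auto.
  - intros p q hp hq e. apply fi in e; auto. now injection e.
  - intros p q hp hq. rewrite <- nca_cons; auto.
Qed.

(** If all images lie below child [j], dropping the common first index leaves an embedding into that
    child. *)
Lemma topological_minor_shift (t : tree) (us : list tree) (g : list nat -> list nat) (j : nat) :
  (forall p, is_node t p -> exists q, g p = j :: q) ->
  (forall p, is_node t p -> is_node (Node us) (g p)) ->
  (forall p q, is_node t p -> is_node t q -> g p = g q -> p = q) ->
  (forall p q, is_node t p -> is_node t q -> g (nca p q) = nca (g p) (g q)) ->
  exists u, nth_error us j = Some u /\ topological_minor t u.
Proof.
  intros gj gn gi gm.
  assert (Ej : exists u, nth_error us j = Some u).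
  { destruct (gj [] (is_node_nil t)) as [q e].
    generalize (gn [] (is_node_nil t)); rewrite e.
    intros (u & E & _)%is_node_cons; eauto. }
  destruct Ej as [u E]; exists u; split; auto.
  exists (fun p => tl (g p)); repeat split.
  - intros p hp. destruct (gj p hp) as [q e].
    generalize (gn p hp); rewrite e.
    intros (u' & E' & hq)%is_node_cons. rewrite E in E'; injection E' as <-; exact hq.
  - intros p q hp hq e. apply gi; auto.
    destruct (gj p hp) as [p' ep], (gj q hq) as [q' eq].
    rewrite ep, eq in *; simpl in e; now rewrite e.
  - intros p q hp hq. rewrite (gm p q hp hq).
    destruct (gj p hp) as [p' ep], (gj q hq) as [q' eq].
    now rewrite ep, eq, nca_cons.
Qed.

(** The cases are whether the root goes to the root. If not, every image has the nonempty path [f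
    []] as a prefix and so lies in one child. If it does, NCA preservation keeps each child subtree
    together and separates distinct ones. *)
Lemma topological_minor_Node (ts us : list tree) :
  topological_minor (Node ts) (Node us) ->
  (exists j u, nth_error us j = Some u /\ topological_minor (Node ts) u) \/
  (exists h : nat -> nat,
     (forall i t, nth_error ts i = Some t ->
        exists u, nth_error us (h i) = Some u /\ topological_minor t u) /\
     (forall i i', (i < length ts)%nat -> (i' < length ts)%nat -> h i = h i' -> i = i')).
Proof.
  intros (f & fn & fi & fm).
  destruct (f []) as [|j r] eqn:E0.
  (* The default [0] is never reached at a child: [f [i]] is nonempty, since [f] is injective and [f
     [] = []]. *)
  - right. exists (fun i => hd 0%nat (f [i])).
    assert (N : forall i t p, nth_error ts i = Some t -> is_node t p ->
              is_node (Node ts) (i :: p)).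
    { intros i t p e hp; apply is_node_cons; eauto. }
    assert (H : forall i t, nth_error ts i = Some t ->
              exists r, f [i] = hd 0%nat (f [i]) :: r).
    { intros i t e. destruct (f [i]) as [|j r] eqn:Ei; simpl; eauto.
      exfalso. assert (X : [i] = []); [|discriminate X].
      apply fi; [apply (N i t [] e), is_node_nil|apply is_node_nil|congruence]. }
    split.
    + intros i t e. destruct (H i t e) as [r er].
      apply topological_minor_shift with (g := fun p => f (i :: p)).
      (* The node [[i]] is the NCA of itself and [i :: p], so [f [i]] is a prefix of
         [f (i :: p)]. *)
      * intros p hp. apply nca_prefix_hd with (p := r).
        rewrite <- er, <- fm.
        -- simpl; now rewrite Nat.eqb_refl.
        -- apply (N i t [] e), is_node_nil.
        -- now apply (N i t).
      * intros p hp; apply fn, (N i t); auto.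
      * intros p q hp hq e'. apply fi in e'; [now injection e'| |]; now apply (N i t).
      * intros p q hp hq. rewrite <- nca_cons. apply fm; now apply (N i t).
    + intros i i' hi hi' e.
      destruct (nth_error ts i) as [t|] eqn:Ei; [|now apply nth_error_None in Ei; lia].
      destruct (nth_error ts i') as [t'|] eqn:Ei'; [|now apply nth_error_None in Ei'; lia].
      destruct (H i t Ei) as [r er], (H i' t' Ei') as [r' er'].
      destruct (Nat.eq_dec i i') as [|ne]; auto. exfalso.
      assert (X : f (nca [i] [i']) = nca (f [i]) (f [i'])).
      { apply fm; [apply (N i t [] Ei)|apply (N i' t' [] Ei')]; apply is_node_nil. }
      (* The NCA of two distinct children is the root, mapped to [[]], but images in one child have
         a nonempty NCA. *)
      simpl in X. rewrite (proj2 (Nat.eqb_neq i i') ne), E0, er, er', e, nca_cons in X.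
      discriminate X.
  - left. exists j. apply topological_minor_shift with (g := f); auto.
    intros p hp. apply nca_prefix_hd with (p := r).
    rewrite <- E0, <- fm; auto. apply is_node_nil.
Qed.

(** * Caterpillars and the trees of words *)

Fixpoint comb (x y : nat) (A : tree) : tree :=
  match x with
  | O => A
  | S x' => Node (comb x' y A :: repeat A y)
  end.

(* The letter [(x, y)] stands for [x + 1] spine nodes carrying [y + 1] copies each. *)
Fixpoint word_tree (s : list (nat * nat)) : tree :=
  match s with
  | [] => Node []
  | (x, y) :: s' => comb (S x) (S y) (word_tree s')
  end.

(** The first child of a comb is the comb with one spine node less. *)
Lemma comb_minor_le (x x' y : nat) (A U : tree) :
  (x <= x')%nat -> topological_minor (comb x' y A) U -> topological_minor (comb x y A) U.
Proof.
  induction 1 as [|x' _ IH]; auto.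
  intros H; apply IH. now apply (topological_minor_child (comb x' y A :: repeat A y) 0).
Qed.

(** * Charging words to the children of the root *)

Section RootCount.

Variable us : list tree.

Definition child_contains (s : list (nat * nat)) (i : nat) : Prop :=
  exists u, nth_error us i = Some u /\ topological_minor (word_tree s) u.

Definition carriers (s : list (nat * nat)) : list nat :=
  filter (fun i => if excluded_middle_informative (child_contains s i) then true else false)
    (seq 0 (length us)).

Lemma In_carriers (s : list (nat * nat)) (i : nat) :
  In i (carriers s) <-> child_contains s i.
Proof.
  unfold carriers; rewrite filter_In, in_seq.
  destruct (excluded_middle_informative _) as [H|H]; [|split; [intros [_ h]; discriminate h|tauto]].
  split; auto. intros _; split; auto. split; [lia|].
  destruct H as (u & E & _). apply nth_error_Some; congruence.
Qed.

Lemma NoDup_carriers (s : list (nat * nat)) : NoDup (carriers s).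
Proof. apply NoDup_filter, seq_NoDup. Qed.

(* Charges a word [s] contained in [Node us] to a pair (child, word in it): a word
   contained in a child to the first such child, a word new at the root to its tail
   and the carrier of the tail whose rank is the second component of the first letter. *)
Definition charge (s : list (nat * nat)) (b : nat * list (nat * nat)) : Prop :=
  (snd b = s /\ nth_error (carriers s) 0 = Some (fst b)) \/
  (exists x y, s = (x, y) :: snd b /\ nth_error (carriers (snd b)) (S y) = Some (fst b) /\
     (forall i u, nth_error us i = Some u ->
        ~ topological_minor (comb (S x) (S y) (word_tree (snd b))) u) /\
     (exists i u, nth_error us i = Some u /\
        topological_minor (comb x (S y) (word_tree (snd b))) u)).

Lemma charge_sound (s : list (nat * nat)) (b : nat * list (nat * nat)) :
  charge s b -> child_contains (snd b) (fst b).
Proof.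
  rewrite <- In_carriers.
  intros [[<- H]|(x & y & _ & H & _)]; apply nth_error_In in H; exact H.
Qed.

(** Since [carriers] has no duplicates, [b] determines a rank: rank 0 means the word itself, rank
    [S y] recovers [y]. If two values of [x] shared a charge, the child holding the spine of the
    longer comb would contain the whole shorter comb, which was supposed to be new at the root. *)
Lemma charge_inj (s s' : list (nat * nat)) (b : nat * list (nat * nat)) :
  charge s b -> charge s' b -> s = s'.
Proof.
  assert (R : forall i j, nth_error (carriers (snd b)) i = Some (fst b) ->
            nth_error (carriers (snd b)) j = Some (fst b) -> i = j).
  { intros i j hi hj. apply (proj1 (NoDup_nth_error _) (NoDup_carriers (snd b))); [|congruence].
    apply nth_error_Some; congruence. }
  intros [[<- H]|(x & y & -> & H & Hn & (i & u & Ei & Hi))]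
    [[E' H']|(x' & y' & -> & H' & Hn' & (i' & u' & Ei' & Hi'))].
  - congruence.
  - now generalize (R _ _ H H').
  - rewrite <- E' in H'. now generalize (R _ _ H H').
  - assert (e := R _ _ H H'). injection e as <-.
    destruct (lt_eq_lt_dec x x') as [[lt|<-]|lt]; auto; exfalso.
    + apply (Hn i' u' Ei'). now apply comb_minor_le with (2 := Hi').
    + apply (Hn' i u Ei). now apply comb_minor_le with (2 := Hi).
Qed.

Lemma charge_exists (s : list (nat * nat)) :
  us <> [] -> topological_minor (word_tree s) (Node us) -> exists b, charge s b.
Proof.
  intros ne H.
  destruct (classic (exists i, child_contains s i)) as [(i & Hi)|Hn].
  { apply In_carriers in Hi. destruct (carriers s) as [|j l] eqn:E; [easy|].
    exists (j, s); left; simpl; now rewrite E. }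
  destruct s as [|[x y] s].
  { destruct us as [|u l] eqn:E; [easy|].
    exfalso; apply Hn. exists 0%nat, u; split; [now rewrite E|]. apply topological_minor_leaf. }
  (* A word in no child must send its root to the root, hence its [S (S y)] children into distinct
     children. *)
  destruct (topological_minor_Node
    (comb x (S y) (word_tree s) :: repeat (word_tree s) (S y)) us H)
    as [(j & u & E & Hu)|(h & Hh & inj)].
  { exfalso; apply Hn; exists j, u; auto. }
  destruct (Hh 0%nat _ eq_refl) as (u0 & E0 & H0).
  assert (inj' : forall i i', (i < S (S y))%nat -> (i' < S (S y))%nat -> h i = h i' -> i = i').
  { intros i i' hi hi'; apply inj; simpl; rewrite repeat_length; lia. }
  assert (C : forall i, (i < S (S y))%nat -> child_contains s (h i)).
  { intros [|i] hi.
    (* The spine child also contains the tail, at its bottom; with the [S y] copies this gives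
       enough carriers for rank [S y] to exist. *)
    - exists u0; split; auto. now apply (comb_minor_le 0 x (S y)); [lia|].
    - apply Hh. apply (nth_error_repeat (word_tree s) (m := S y)); lia. }
  assert (L : (S (S y) <= length (carriers s))%nat).
  { rewrite <- (length_seq (S (S y)) 0), <- (length_map h).
    apply NoDup_incl_length.
    - apply NoDup_map_NoDup_ForallPairs; [|apply seq_NoDup].
      intros i j hi hj. apply in_seq in hi, hj. apply inj'; lia.
    - intros j (i & <- & hi)%in_map_iff. apply in_seq in hi.
      apply In_carriers, C; lia. }
  destruct (nth_error (carriers s) (S y)) as [j|] eqn:Ej;
    [|apply nth_error_None in Ej; lia].
  exists (j, s); right; exists x, y; simpl snd; repeat split; auto.
  - intros i u E Hu. apply Hn. exists i, u; auto.
  - exists (h 0%nat), u0; auto.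
Qed.

End RootCount.

(** * Bounding the number of words by the number of leaves *)

Lemma NoDup_image (A B : Type) (R : A -> B -> Prop) (l : list A) :
  (forall a a' b, R a b -> R a' b -> a = a') -> (forall a, In a l -> exists b, R a b) ->
  NoDup l ->
  exists m, NoDup m /\ length m = length l /\ forall b, In b m -> exists a, In a l /\ R a b.
Proof.
  intros inj; induction l as [|a l IH]; intros ex nd.
  { exists []; repeat split; [constructor|easy]. }
  inversion nd as [|? ? na nd']; subst.
  destruct IH as (m & ndm & len & Hm); auto.
  { intros; apply ex; now right. }
  destruct (ex a (or_introl eq_refl)) as [b Rb].
  exists (b :: m); repeat split.
  - constructor; auto. intros (a' & ha' & Ra')%Hm.
    apply na. now rewrite (inj a a' b Rb Ra').
  - simpl; now rewrite len.
  - intros b' [<-|(a' & ha' & Ra')%Hm]; [exists a|exists a']; simpl; auto.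
Qed.

Lemma NoDup_pairs_length (A T : Type) (Q : A -> T -> Prop) (size : T -> nat) (us : list T) :
  (forall u, In u us -> forall l, NoDup l -> (forall a, In a l -> Q a u) ->
     (length l <= size u)%nat) ->
  forall m : list (nat * A), NoDup m ->
  (forall b, In b m -> exists u, nth_error us (fst b) = Some u /\ Q (snd b) u) ->
  (length m <= list_sum (map size us))%nat.
Proof.
  induction us as [|u us IH]; intros bound m nd Hm.
  { destruct m as [|b m]; auto.
    destruct (Hm b (or_introl eq_refl)) as (u & E & _). now destruct (fst b). }
  (* Pairs at index 0 are counted by [bound] for the first tree; the others go to the induction
     hypothesis with their index lowered by one. *)
  rewrite <- (filter_length (fun b => Nat.eqb (fst b) 0) m). simpl.
  apply Nat.add_le_mono.
  - rewrite <- (length_map snd). apply (bound u (or_introl eq_refl)).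
    + apply NoDup_map_NoDup_ForallPairs; [|now apply NoDup_filter].
      intros [i a] [j a'] [_ hi]%filter_In [_ hj]%filter_In.
      apply Nat.eqb_eq in hi, hj; simpl in *; congruence.
    + intros a ([i a'] & <- & [hb hi]%filter_In)%in_map_iff.
      apply Nat.eqb_eq in hi. destruct (Hm _ hb) as (u' & E & H).
      simpl in *; subst i. injection E as <-; exact H.
  - rewrite <- (length_map (fun b => (pred (fst b), snd b))). apply IH.
    + intros u' h; apply bound; now right.
    + apply NoDup_map_NoDup_ForallPairs; [|now apply NoDup_filter].
      intros [[|i] a] [[|j] a'] [_ hi]%filter_In [_ hj]%filter_In; try discriminate.
      simpl; congruence.
    + intros b ([[|i] a'] & <- & [hb hi]%filter_In)%in_map_iff; [discriminate|].
      exact (Hm _ hb).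
Qed.

Lemma words_le_nleaves (U : tree) (l : list (list (nat * nat))) :
  NoDup l -> (forall s, In s l -> topological_minor (word_tree s) U) ->
  (length l <= nleaves U)%nat.
Proof.
  revert l; induction U as [us IH] using tree_nested_ind; intros l nd Hl.
  destruct us as [|u us'].
  (* A single leaf contains only the tree of the empty word. *)
  - assert (H : forall s, In s l -> s = []).
    { intros s hs. destruct s as [|[x y] s]; auto; exfalso.
      destruct (topological_minor_Node _ _ (Hl _ hs)) as [(j & v & E & _)|(h & Hh & _)].
      - now destruct j.
      - destruct (Hh 0%nat _ eq_refl) as (v & E & _). now destruct (h 0%nat). }
    change (length l <= length [@nil (nat * nat)])%nat.
    apply NoDup_incl_length; auto.
    intros s hs; left; now rewrite (H s hs).
  - set (us := u :: us') in *.
    destruct (NoDup_image _ _ (charge us) l) as (m & ndm & <- & Hm); auto.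
    { intros a a' b; apply charge_inj. }
    { intros s hs; apply charge_exists; [discriminate|auto]. }
    change (nleaves (Node us)) with (list_sum (map nleaves us)).
    apply NoDup_pairs_length with (Q := fun s u => topological_minor (word_tree s) u); auto.
    intros b (s & _ & Hb)%Hm. exact (charge_sound _ _ _ Hb).
Qed.

(** * Leaves and degrees of the trees of words *)

Lemma nleaves_Node_cons (t : tree) (ts : list tree) :
  nleaves (Node (t :: ts)) = (nleaves t + list_sum (map nleaves ts))%nat.
Proof. reflexivity. Qed.

Lemma list_sum_nleaves_repeat (t : tree) (n : nat) :
  list_sum (map nleaves (repeat t n)) = (n * nleaves t)%nat.
Proof. induction n as [|n IH]; simpl; auto. Qed.

Lemma nleaves_comb (x y : nat) (A : tree) : nleaves (comb x y A) = ((x * y + 1) * nleaves A)%nat.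
Proof.
  induction x as [|x IH]; [simpl; lia|].
  cbn [comb]. rewrite nleaves_Node_cons, IH, list_sum_nleaves_repeat. lia.
Qed.

Lemma no_degree_one_Node (ts : list tree) :
  length ts <> 1%nat -> (forall t, In t ts -> no_degree_one t) -> no_degree_one (Node ts).
Proof.
  intros len H [|i p] c; simpl.
  - intros E; injection E as ->; now apply len.
  - destruct (nth_error ts i) as [t|] eqn:E; [|discriminate].
    apply H. now apply nth_error_In in E.
Qed.

Lemma no_degree_one_comb (x y : nat) (A : tree) :
  no_degree_one A -> no_degree_one (comb x (S y) A).
Proof.
  intros HA; induction x as [|x IH]; auto.
  apply no_degree_one_Node; [easy|].
  intros t [<-|h]; auto. apply repeat_spec in h; now subst.
Qed.

Lemma no_degree_one_word_tree (s : list (nat * nat)) : no_degree_one (word_tree s).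
Proof.
  induction s as [|[x y] s IH].
  - apply no_degree_one_Node; easy.
  - now apply no_degree_one_comb.
Qed.

(** A smaller tree is padded to exactly [n] leaves by hanging it with extra leaves below a new root,
    which has degree at least 2 because at least one leaf is missing. *)
Lemma universal_le (n : nat) (U T : tree) :
  universal n U -> no_degree_one T -> (nleaves T <= n)%nat -> topological_minor T U.
Proof.
  intros HU HT le.
  destruct (Nat.eq_dec (nleaves T) n) as [e|ne]; [now apply HU|].
  apply (topological_minor_child (T :: repeat (Node []) (n - nleaves T)) 0); [reflexivity|].
  apply HU.
  - rewrite nleaves_Node_cons, list_sum_nleaves_repeat. simpl; lia.
  - apply no_degree_one_Node.
    + simpl; rewrite repeat_length; lia.
    + intros t [<-|h]; auto. apply repeat_spec in h; subst.
      exact (no_degree_one_word_tree []).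
Qed.

(** * From the double series to a finite set of letters *)

Lemma Lim_seq_sum_nonneg (a : nat -> R) :
  (forall n, 0 <= a n) -> Rbar_le 0 (Lim_seq (sum_n a)).
Proof.
  intros pos. rewrite <- (Lim_seq_const 0). apply Lim_seq_le_loc, filter_forall; intros n.
  induction n as [|n IH]; [now rewrite sum_O|].
  rewrite sum_Sn. apply Rplus_le_le_0_compat; auto.
Qed.

(* The junk value 0 of a divergent [Series] makes convergence irrelevant here. *)
Lemma Series_gt_partial (a : nat -> R) (l : R) :
  (forall n, 0 <= a n) -> l < Series a -> exists N, l < sum_n a N.
Proof.
  intros pos H. apply NNPP; intros no.
  assert (le : Rbar_le (Lim_seq (sum_n a)) l).
  { rewrite <- (Lim_seq_const l). apply Lim_seq_le_loc, filter_forall; intros n.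
    apply Rnot_lt_le; intros h; apply no; eauto. }
  generalize (Lim_seq_sum_nonneg a pos) le; unfold Series in H.
  destruct (Lim_seq (sum_n a)); simpl in *; lra.
Qed.

Lemma Series_nonneg (a : nat -> R) : (forall n, 0 <= a n) -> 0 <= Series a.
Proof.
  intros pos. generalize (Lim_seq_sum_nonneg a pos); unfold Series.
  destruct (Lim_seq (sum_n a)); simpl; lra.
Qed.

Definition sumR {A : Type} (F : A -> R) (l : list A) : R :=
  fold_right (fun a r => F a + r) 0 l.

Lemma sumR_app (A : Type) (F : A -> R) (l l' : list A) :
  sumR F (l ++ l') = sumR F l + sumR F l'.
Proof. induction l as [|a l IH]; simpl; [|rewrite IH]; lra. Qed.

Lemma sumR_row (b : nat * nat -> R) (x M : nat) :
  sumR b (map (pair x) (seq 0 (S M))) = sum_n (fun y => b (x, y)) M.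
Proof.
  induction M as [|M IH]; [rewrite sum_O; simpl; lra|].
  rewrite seq_S, map_app, sumR_app, IH, sum_Sn. simpl. unfold plus; simpl. lra.
Qed.

Lemma NoDup_row (x M : nat) : NoDup (map (pair x) (seq 0 M)).
Proof.
  apply NoDup_map_NoDup_ForallPairs; [|apply seq_NoDup].
  intros i j _ _ e; congruence.
Qed.

Lemma double_Series_gt_finite (b : nat * nat -> R) (l : R) :
  (forall p, 0 <= b p) -> l < Series (fun x => Series (fun y => b (x, y))) ->
  exists P, NoDup P /\ l < sumR b P.
Proof.
  intros pos H. apply Series_gt_partial in H; [|intros x; apply Series_nonneg; auto].
  destruct H as [N H].
  cut (exists P, NoDup P /\ (forall p, In p P -> (fst p <= N)%nat) /\ l < sumR b P).
  { intros (P & ? & _ & ?); eauto. }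
  revert l H; induction N as [|N IH]; intros l H.
  - rewrite sum_O in H. apply Series_gt_partial in H; auto. destruct H as [M H].
    exists (map (pair 0%nat) (seq 0 (S M))). rewrite sumR_row.
    repeat split; auto using NoDup_row.
    intros p (y & <- & _)%in_map_iff; auto.
  - rewrite sum_Sn in H. unfold plus in H; simpl in H.
    set (A := sum_n _ N) in *. set (B := Series _) in H.
    (* The slack [A + B - l] is shared equally between the earlier rows and row [S N]. *)
    destruct (IH (A - (A + B - l) / 2)) as (P & nd & Hf & HP); [lra|].
    destruct (Series_gt_partial (fun y => b (S N, y)) (B - (A + B - l) / 2)) as [M HM];
      [auto|fold B; lra|].
    exists (P ++ map (pair (S N)) (seq 0 (S M))). repeat split.
    + apply NoDup_app; auto using NoDup_row.
      intros p hp (y & <- & _)%in_map_iff. apply Hf in hp; simpl in hp; lia.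
    + intros p [hp|(y & <- & _)%in_map_iff]%in_app_iff; auto.
    + rewrite sumR_app, sumR_row. lra.
Qed.

(** * Many words with few leaves *)

Definition weight (p : nat * nat) : R := INR ((fst p + 1) * (snd p + 1)) + 1.

Lemma weight_ge_2 (p : nat * nat) : 2 <= weight p.
Proof.
  unfold weight. assert (H : (1 <= (fst p + 1) * (snd p + 1))%nat) by lia.
  apply le_INR in H; simpl in H; lra.
Qed.

Lemma nleaves_word_tree_cons (p : nat * nat) (s : list (nat * nat)) :
  INR (nleaves (word_tree (p :: s))) = weight p * INR (nleaves (word_tree s)).
Proof.
  destruct p as [x y]; cbn [word_tree]; rewrite nleaves_comb, mult_INR, plus_INR.
  unfold weight; simpl fst; simpl snd. now rewrite !Nat.add_1_r.
Qed.

Lemma weight_bound (P : list (nat * nat)) :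
  exists W, 2 <= W /\ forall p, In p P -> weight p <= W.
Proof.
  induction P as [|p P (W & hW & H)].
  { exists 2; split; [lra|easy]. }
  exists (Rmax W (weight p)); split; [eapply Rle_trans; [exact hW|apply Rmax_l]|].
  intros q [<-|h]; [apply Rmax_r|].
  eapply Rle_trans; [now apply H|apply Rmax_l].
Qed.

(** Words with different first letters differ, so the counts add up. The clause on first letters is
    carried along to give this disjointness in the induction. *)
Lemma words_prepend (t d : R) (F : nat * nat -> R) (P : list (nat * nat)) :
  NoDup P ->
  (forall p, In p P -> exists L, NoDup L /\
     (forall s, In s L -> INR (nleaves (word_tree s)) <= t / weight p) /\
     d * F p <= INR (length L)) ->
  exists L, NoDup L /\
    (forall s, In s L -> INR (nleaves (word_tree s)) <= t) /\
    (forall p s, In (p :: s) L -> In p P) /\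
    d * sumR F P <= INR (length L).
Proof.
  induction P as [|p P IH]; intros nd H.
  { exists []; repeat split; try easy; [constructor|simpl; lra]. }
  inversion nd as [|? ? np nd']; subst.
  destruct IH as (L & ndL & HL & inL & len); auto.
  { intros; apply H; now right. }
  destruct (H p (or_introl eq_refl)) as (L0 & nd0 & H0 & len0).
  exists (map (cons p) L0 ++ L); repeat split.
  - apply NoDup_app; auto.
    + apply NoDup_map_NoDup_ForallPairs; auto. intros i j _ _ e; congruence.
    + intros q (s & <- & _)%in_map_iff hq. apply np; eauto.
  - intros q [(s & <- & hs)%in_map_iff|hq]%in_app_iff; auto.
    rewrite nleaves_word_tree_cons. generalize (weight_ge_2 p); intros w.
    apply Rmult_le_reg_l with (/ weight p); [apply Rinv_0_lt_compat; lra|].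
    rewrite <- Rmult_assoc, Rinv_l, Rmult_1_l, Rmult_comm by lra. now apply H0.
  - intros q s [(s' & e & _)%in_map_iff|hq]%in_app_iff; [left; congruence|right; eauto].
  - rewrite length_app, length_map, plus_INR. simpl. lra.
Qed.

(** The recursion of [t] to [t / weight p] at least halves [t], so [k] bounds its depth. With
    [a = W^(-c)], where [W] bounds all weights, the base range [t < W] needs only one word; for
    [t >= W] every quotient stays at least 1. *)
Lemma many_words (c : R) (P : list (nat * nat)) :
  0 < c -> NoDup P -> 1 < sumR (fun p => Rpower (weight p) (- c)) P ->
  exists a, 0 < a /\ forall k t, 1 <= t <= 2 ^ k ->
    exists L, NoDup L /\ (forall s, In s L -> INR (nleaves (word_tree s)) <= t) /\
      a * Rpower t c <= INR (length L).
Proof.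
  intros hc nd HP. destruct (weight_bound P) as (W & hW & HW).
  exists (Rpower W (- c)); split; [apply exp_pos|].
  assert (small : forall t, 1 <= t < W ->
    exists L, NoDup L /\ (forall s, In s L -> INR (nleaves (word_tree s)) <= t) /\
      Rpower W (- c) * Rpower t c <= INR (length L)).
  { intros t ht. exists [[]]; repeat split.
    - repeat constructor; easy.
    - intros s [<-|[]]; simpl; lra.
    - simpl. rewrite Rpower_Ropp.
      apply Rmult_le_reg_l with (Rpower W c); [apply exp_pos|].
      rewrite <- Rmult_assoc, Rinv_r, Rmult_1_l, Rmult_1_r
        by (apply Rgt_not_eq, exp_pos).
      apply Rle_Rpower_l; lra. }
  intros k; induction k as [|k IH]; intros t ht.
  { apply small; simpl in ht; lra. }
  destruct (Rlt_le_dec t W) as [lt|le]; [apply small; lra|].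
  destruct (words_prepend t (Rpower W (- c) * Rpower t c)
              (fun p => Rpower (weight p) (- c)) P nd) as (L & ndL & HL & _ & len).
  - intros p hp. generalize (weight_ge_2 p) (HW p hp); intros w2 wW.
    destruct (IH (t / weight p)) as (L & ndL & HL & len).
    { split.
      - apply Rle_div_r; lra.
      - apply Rle_div_l; [lra|]. simpl in ht.
        apply Rle_trans with (2 ^ k * 2); [lra|].
        apply Rmult_le_compat_l; [apply pow_le|]; lra. }
    exists L; repeat split; auto.
    eapply Rle_trans; [|exact len]. right.
    (* The bound for [t / weight p] is that for [t] times [weight p ^ (-c)]; these factors sum to
       more than 1 over [P]. *)
    unfold Rdiv.
    rewrite <- (Rpower_mult_distr t (/ weight p)) by (try apply Rinv_0_lt_compat; lra).
    rewrite Rmult_assoc; f_equal; f_equal.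
    unfold Rpower. rewrite ln_Rinv by lra. f_equal; ring.
  - exists L; repeat split; auto.
    eapply Rle_trans; [|exact len].
    rewrite <- (Rmult_1_r (_ * _)) at 1.
    apply Rmult_le_compat_l; [|lra].
    apply Rmult_le_pos; left; apply exp_pos.
Qed.

Lemma le_pow2_INR (n : nat) : INR n <= 2 ^ n.
Proof.
  change 2 with (INR 2). rewrite <- pow_INR. apply le_INR.
  induction n as [|n IH]; simpl; [lia|].
  assert (1 <= 2 ^ n)%nat by (apply Nat.neq_0_lt_0, Nat.pow_nonzero; lia). lia.
Qed.

(* u(n) = min { nleaves U | universal n U }; "u(n) >= a n^c" is stated as:
   every universal U has at least a n^c leaves. *)
Theorem theorem8 (c : R) (hc : 1 < c)
  (hsum : Series (fun x : nat =>
            Series (fun y : nat =>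
              Rpower (INR ((x + 1) * (y + 1)) + 1) (- c))) > 1) :
  exists a : R, 0 < a /\
    forall n : nat, (1 <= n)%nat ->
    forall U : tree, universal n U ->
      a * Rpower (INR n) c <= INR (nleaves U).
Proof.
  destruct (double_Series_gt_finite (fun p => Rpower (weight p) (- c)) 1) as (P & nd & HP).
  { intros p; left; apply exp_pos. }
  { exact hsum. }
  destruct (many_words c P) as (a & ha & H); auto; [lra|].
  exists a; split; auto. intros n hn U HU.
  (* Depth [n] suffices, as [n <= 2 ^ n]. *)
  destruct (H n (INR n)) as (L & ndL & HL & len).
  { split; [now apply (le_INR 1)|apply le_pow2_INR]. }
  eapply Rle_trans; [exact len|]. apply le_INR, words_le_nleaves; auto.
  intros s hs. apply universal_le with n; auto using no_degree_one_word_tree.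
  now apply INR_le, HL.
Qed.
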